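(* Let $n\geqslant 4$ and let $\langle a_0,b_0,e_0,z\mid Q\rangle$ be a presentation of the monoid $\mathrm{End}\,S_n$ on the generators $a_0$, $b_0$, $e_0$ and $z$. Then $$ \langle a_0,b_0,e_0,z,z_0 \mid Q,\ a_0z_0=b_0z_0=e_0z_0=zz_0=z_0^2=z_0a_0=z_0b_0=z_0e_0=z_0 \rangle $$ is a presentation of $\mathrm{swEnd}\,S_n$ on the generators $a_0$, $b_0$, $e_0$, $z$ and $z_0$.
   Context: For an integer $n\geqslant 1$, let $\Omega_{n-1}^0=\{0,1,\ldots,n-1\}$ and let $S_n$ be the star graph with vertex set $\Omega_{n-1}^0$ and edge set $E=\{\{0,i\}\mid 1\leqslant i\leqslant n-1\}$. Maps are written on the right of their arguments and composed from left to right (so $x(\alpha\beta)=(x\alpha)\beta$). A map $\alpha:\Omega_{n-1}^0\to\Omega_{n-1}^0$ is an endomorphism of $S_n$ if $\{u,v\}\in E$ implies $\{u\alpha,v\alpha\}\in E$ for all vertices $u,v$; it is a strong weak endomorphism of $S_n$ if, for all vertices $u,v$, ($\{u,v\}\in E$ and $u\alpha\neq v\alpha$) if and only if $\{u\alpha,v\alpha\}\in E$. $\mathrm{End}\,S_n$ and $\mathrm{swEnd}\,S_n$ are the monoids under composition of all endomorphisms and of all strong weak endomorphisms of $S_n$, respectively. $\mathrm{End}\,S_n$ is generated by $a_0,b_0,e_0,z$. The following are full transformations of $\Omega_{n-1}^0$: - $a_0$: $0\mapsto 0$, $1\mapsto 2$, $2\mapsto 1$, and $i\mapsto i$ for $3\leqslant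 i\leqslant n-1$; - $b_0$: $0\mapsto 0$, $i\mapsto i+1$ for $1\leqslant i\leqslant n-2$, and $n-1\mapsto 1$; - $e_0$: $0\mapsto 0$, $1\mapsto 1$, $2\mapsto 1$, and $i\mapsto i$ for $3\leqslant i\leqslant n-1$; - $z$: $0\mapsto 1$ and $i\mapsto 0$ for $1\leqslant i\leqslant n-1$; - $z_0$: $i\mapsto 0$ for all $0\leqslant i\leqslant n-1$. Presentations: for an alphabet $X$, $X^*$ is the free monoid on $X$; a monoid presentation is a pair $\langle X\mid R\rangle$ with $R\subseteq X^*\times X^*$, and a pair $(u,v)\in R$ is written as a relation $u=v$ (a chain $u_1=u_2=\cdots=u_k$ abbreviates the corresponding relations between its terms). Let $\sim_R$ be the congruence on $X^*$ generated by $R$. If $X$ is a subset of a monoid $M$ generating $M$, then $\langle X\mid R\rangle$ is a presentation of $M$ on the generators $X$ if, for all $w_1,w_2\in X^*$, $w_1\sim_R w_2$ if and only if $w_1$ and $w_2$ represent the same element of $M$ (equivalently, the canonical homomorphism $X^*\to M$ induces an isomorphism $X^*/{\sim_R}\cong M$). The same symbols are used for the letters and for the elements of $M$ they represent. *)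

(* Defs.v *)
From HB Require Import structures.
From mathcomp Require Import all_boot monoid.

Set Implicit Arguments.
Unset Strict Implicit.
Unset Printing Implicit Defensive.

Local Open Scope group_scope.

(* An alias of {ffun T -> T}, so that composition does not compete with the
   pointwise product of finite functions.  Maps are written on the right:
   f * g is f followed by g. *)
Definition transf (T : finType) : Type := {ffun T -> T}.

HB.instance Definition _ (T : finType) := Finite.copy (transf T) {ffun T -> T}.

Section TransfMonoid.
Variable T : finType.
Implicit Types f g h : transf T.

Definition transf_mul f g : transf T := [ffun x => g (f x)].
Definition transf_one : transf T := [ffun x => x].

Fact transf_mulA : associative transf_mul.
Proof. by move=> f g h; apply/ffunP => x; rewrite !ffunE. Qed.

Fact transf_mul1 : left_id transf_one transf_mul.
Proof. by move=> f; apply/ffunP => x; rewrite !ffunE. Qed.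

Fact transf_1mul : right_id transf_one transf_mul.
Proof. by move=> f; apply/ffunP => x; rewrite !ffunE. Qed.

HB.instance Definition _ :=
  isMonoid.Build (transf T) transf_mulA transf_mul1 transf_1mul.

End TransfMonoid.

Definition endomorphism (T : finType) (e : rel T) : {pred transf T} :=
  [pred f : transf T | [forall u, forall v, e u v ==> e (f u) (f v)]].

Definition strong_weak_endomorphism (T : finType) (e : rel T) :
    {pred transf T} :=
  [pred f : transf T | [forall u, forall v, (e u v && (f u != f v)) == e (f u) (f v)]].

Definition star (n : nat) : rel 'I_n :=
  fun u v => ((u == 0 :> nat) && (1 <= v)) || ((v == 0 :> nat) && (1 <= u)).

Arguments star : clear implicits.

Definition End_star (n : nat) : {pred transf 'I_n} := endomorphism (star n).

Definition swEnd_star (n : nat) : {pred transf 'I_n} :=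
  strong_weak_endomorphism (star n).

Arguments End_star : clear implicits.
Arguments swEnd_star : clear implicits.

Section StarMonoids.
Variable n : nat.

Fact End_star_mul : mulg_closed (End_star n).
Proof.
move=> f g /forallP Hf /forallP Hg.
apply/forallP => u; apply/forallP => v; apply/implyP => uv; rewrite !ffunE.
have /forallP/(_ v)/implyP/(_ uv) fuv := Hf u.
by have /forallP/(_ (f v))/implyP/(_ fuv) := Hg (f u).
Qed.

Fact End_star_one : 1 \in End_star n.
Proof. by apply/forallP => u; apply/forallP => v; rewrite !ffunE implybb. Qed.

HB.instance Definition _ :=
  isMulClosed.Build (transf 'I_n) (End_star n) End_star_mul.
HB.instance Definition _ :=
  isMul1Closed.Build (transf 'I_n) (End_star n) End_star_one.

Fact swEnd_star_mul : mulg_closed (swEnd_star n).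
Proof.
move=> f g /forallP Hf /forallP Hg.
apply/forallP => u; apply/forallP => v; rewrite !ffunE.
have /forallP/(_ v)/eqP fuv := Hf u.
have /forallP/(_ (f v))/eqP <- := Hg (f u).
by rewrite -fuv -andbA; case: (f u =P f v) => // ->; rewrite eqxx.
Qed.

Fact swEnd_star_one : 1 \in swEnd_star n.
Proof.
apply/forallP => u; apply/forallP => v; rewrite !ffunE.
by case: (u =P v) => [->|_]; rewrite ?andbT // andbF /star; case: (val v).
Qed.

HB.instance Definition _ :=
  isMulClosed.Build (transf 'I_n) (swEnd_star n) swEnd_star_mul.
HB.instance Definition _ :=
  isMul1Closed.Build (transf 'I_n) (swEnd_star n) swEnd_star_one.

End StarMonoids.

(* For 4 <= n each formula below maps {0, ..., n - 1} to itself, so the default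
   value of insubd is never used. *)
Definition transf_of_nat (n : nat) (f : nat -> nat) : transf 'I_n :=
  [ffun i : 'I_n => insubd i (f i)].

Definition a0 (n : nat) : transf 'I_n :=
  transf_of_nat n (fun i => if i == 1%N then 2 else if i == 2 then 1%N else i).

Definition b0 (n : nat) : transf 'I_n :=
  transf_of_nat n
    (fun i => if i == 0 then 0 else if i <= n - 2 then i.+1 else 1%N).

Definition e0 (n : nat) : transf 'I_n :=
  transf_of_nat n (fun i => if i == 2 then 1%N else i).

Definition z (n : nat) : transf 'I_n :=
  transf_of_nat n (fun i => if i == 0 then 1%N else 0).

Definition z0 (n : nat) : transf 'I_n := transf_of_nat n (fun=> 0).

Section Presentations.
Variable X : Type.

(* Elements of the free monoid X^* are words w : seq X, multiplied by ++. *)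
Inductive congruence_gen (R : seq X -> seq X -> Prop) :
    seq X -> seq X -> Prop :=
| cong_rel u v : R u v -> congruence_gen R u v
| cong_refl u : congruence_gen R u u
| cong_sym u v : congruence_gen R u v -> congruence_gen R v u
| cong_trans u v w :
    congruence_gen R u v -> congruence_gen R v w -> congruence_gen R u w
| cong_cat u u' v v' :
    congruence_gen R u u' -> congruence_gen R v v' ->
    congruence_gen R (u ++ v) (u' ++ v').

Variable M : monoidType.

Definition represents (gen : X -> M) (w : seq X) : M := \prod_(x <- w) gen x.

(* <X | R> presents the submonoid S of M; the letter x stands for gen x, and
   gen identifies X with a generating subset of S. *)
Definition is_presentation (S : umagmaClosed M) (gen : X -> M)
    (R : seq X -> seq X -> Prop) : Prop :=
  [/\ injective gen,
      forall x, gen x \in S,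
      forall m, m \in S -> exists w, represents gen w = m &
      forall w1 w2,
        congruence_gen R w1 w2 <-> represents gen w1 = represents gen w2].

End Presentations.

Inductive End_letter := La0 | Lb0 | Le0 | Lz.

Definition End_gen (n : nat) (x : End_letter) : transf 'I_n :=
  match x with La0 => a0 n | Lb0 => b0 n | Le0 => e0 n | Lz => z n end.

Inductive swEnd_letter := Lold of End_letter | Lz0.

Coercion Lold : End_letter >-> swEnd_letter.

Definition swEnd_gen (n : nat) (x : swEnd_letter) : transf 'I_n :=
  match x with Lold y => End_gen n y | Lz0 => z0 n end.

Inductive swEnd_rel (Q : seq End_letter -> seq End_letter -> Prop) :
    seq swEnd_letter -> seq swEnd_letter -> Prop :=
| rel_Q u v : Q u v -> swEnd_rel Q (map Lold u) (map Lold v)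
| rel_a0z0 : swEnd_rel Q [:: La0 : swEnd_letter; Lz0] [:: Lz0]
| rel_b0z0 : swEnd_rel Q [:: Lb0 : swEnd_letter; Lz0] [:: Lz0]
| rel_e0z0 : swEnd_rel Q [:: Le0 : swEnd_letter; Lz0] [:: Lz0]
| rel_zz0 : swEnd_rel Q [:: Lz : swEnd_letter; Lz0] [:: Lz0]
| rel_z0z0 : swEnd_rel Q [:: Lz0; Lz0] [:: Lz0]
| rel_z0a0 : swEnd_rel Q [:: Lz0; La0 : swEnd_letter] [:: Lz0]
| rel_z0b0 : swEnd_rel Q [:: Lz0; Lb0 : swEnd_letter] [:: Lz0]
| rel_z0e0 : swEnd_rel Q [:: Lz0; Le0 : swEnd_letter] [:: Lz0].

(* Main.v *)
(** Every map in swEnd S_n is an endomorphism or a constant map, and no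
    endomorphism is constant.  The new relations rewrite any word into one
    without z_0 or one of the form z_0 u with u a word over the old letters, so
    it remains to show that z_0 u = z_0 v follows from the relations when u and
    v agree at 0.  If this common value is nonzero, then u and v are the same
    endomorphism.  If it is 0, then z_0 u = z_0: letters of u other than z are
    absorbed by z_0, and when u begins with z it represents a map 0 |-> 0,
    i |-> j, which is also represented by (b_0 e_0)^n b_0^(j-1), a word
    absorbed by z_0. *)
Require Import Defs.
From mathcomp Require Import all_boot monoid.
From mathcomp Require Import zify.

Set Implicit Arguments.
Unset Strict Implicit.
Unset Printing Implicit Defensive.

Local Open Scope group_scope.

(** * Transformations, constant maps and the elements represented by words *)

Lemma transf_mulE (T : finType) (f g : transf T) x : (f * g) x = g (f x).
Proof. exact: ffunE. Qed.

Lemma transf_oneE (T : finType) x : (1 : transf T) x = x.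
Proof. exact: ffunE. Qed.

Definition transf_const (T : finType) (c : T) : transf T := [ffun=> c].

Lemma transf_mul_const (T : finType) (f : transf T) c :
  f * transf_const c = transf_const c.
Proof. by apply/ffunP => x; rewrite transf_mulE !ffunE. Qed.

Lemma transf_const_mul (T : finType) (f : transf T) c :
  transf_const c * f = transf_const (f c).
Proof. by apply/ffunP => x; rewrite transf_mulE !ffunE. Qed.

Lemma transf_of_natE n (f : nat -> nat) (i : 'I_n) :
  f i < n -> transf_of_nat n f i = f i :> nat.
Proof. by move=> fi; rewrite ffunE val_insubd fi. Qed.

Lemma represents_nil (X : Type) (M : monoidType) (gen : X -> M) :
  represents gen [::] = 1.
Proof. exact: big_nil. Qed.

Lemma represents_cons (X : Type) (M : monoidType) (gen : X -> M) x w :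
  represents gen (x :: w) = gen x * represents gen w.
Proof. exact: big_cons. Qed.

Lemma represents_cat (X : Type) (M : monoidType) (gen : X -> M) u v :
  represents gen (u ++ v) = represents gen u * represents gen v.
Proof. exact: big_cat. Qed.

Lemma congruence_gen_sound (X : Type) (M : monoidType) (gen : X -> M)
    (R : seq X -> seq X -> Prop) :
  (forall u v, R u v -> represents gen u = represents gen v) ->
  forall u v, congruence_gen R u v -> represents gen u = represents gen v.
Proof.
move=> RE u v; elim=> {u v} [u v /RE //|//|//|u v w _ -> _ -> //|].
by move=> u u' v v' _ Eu _ Ev; rewrite !represents_cat Eu Ev.
Qed.

(** * Endomorphisms and strong weak endomorphisms of the star with centre [ord0] *)

Section Star.
Variable n : nat.
Implicit Types f : transf 'I_n.+1.

Lemma starE (u v : 'I_n.+1) : star n.+1 u v = (u == ord0) (+) (v == ord0).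
Proof. by rewrite /star -!val_eqE /=; case: (val u); case: (val v). Qed.

(** Every edge joins the centre to a leaf, so only the images of the pairs [ord0], [i] matter, and
    exactly one of the two images must be the centre. *)
Lemma End_starP f :
  reflect (forall i, i != ord0 -> (f i == ord0) = (f ord0 != ord0))
          (f \in End_star n.+1).
Proof.
apply: (iffP idP) => [/forallP fE i i0|fE].
  have /forallP/(_ i)/implyP := fE ord0.
  rewrite !starE eqxx (negPf i0) => /(_ isT).
  by case: (f ord0 == _); case: (f i == _).
apply/forallP => u; apply/forallP => v; apply/implyP; rewrite !starE.
have [->|u0] := eqVneq u ord0; have [->|v0] := eqVneq v ord0 => //= _.
  by rewrite (fE v) //; case: (f ord0 == _).
by rewrite (fE u) //; case: (f ord0 == _).
Qed.

Lemma transf_const_notin_End (c : 'I_n.+1) :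
  0 < n -> transf_const c \notin End_star n.+1.
Proof.
move=> n_gt0; apply/negP => /End_starP/(_ ord_max).
rewrite -val_eqE -lt0n => /(_ n_gt0).
by rewrite !ffunE; case: (c == _).
Qed.

(** Edges go to edges, and two leaves go either both to the centre or both to leaves, so no new
    adjacency arises. *)
Lemma End_star_sub_swEnd f : f \in End_star n.+1 -> f \in swEnd_star n.+1.
Proof.
move=> /End_starP fE; apply/forallP => u; apply/forallP => v; rewrite !starE.
have f0_neq i : i != ord0 -> f ord0 != f i.
  by move=> /fE fi; apply/eqP => f0i; move: fi; rewrite -f0i; case: (f ord0 == _).
have [->|u0] := eqVneq u ord0; have [->|v0] := eqVneq v ord0 => //=.
- by rewrite addbb.
- by rewrite f0_neq // (fE v) //; case: (f ord0 == _).
- by rewrite (eq_sym (f u)) f0_neq // (fE u) //; case: (f ord0 == _).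
- by rewrite (fE u) // (fE v) // addbb.
Qed.

Lemma transf_const_swEnd (c : 'I_n.+1) : transf_const c \in swEnd_star n.+1.
Proof.
by apply/forallP => u; apply/forallP => v; rewrite !ffunE eqxx andbF starE addbb.
Qed.

Lemma swEnd_star_cases f :
  f \in swEnd_star n.+1 -> f \in End_star n.+1 \/ exists c, f = transf_const c.
Proof.
move=> /forallP fE.
have edge u v : star n.+1 u v && (f u != f v) = star n.+1 (f u) (f v).
  by have /forallP/(_ v)/eqP := fE u.
(* Either some leaf [i] has the same image as the centre, or no edge is collapsed and [f] is an
   endomorphism. *)
case: (pickP (fun i => (i != ord0) && (f i == f ord0))) => [i|noi]; last first.
  left; apply/forallP => u; apply/forallP => v; apply/implyP => uv.
  rewrite -edge uv /=; move: uv; rewrite starE.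
  have [->|u0] := eqVneq u ord0; have [->|v0] := eqVneq v ord0 => //= _.
    by rewrite eq_sym; have := noi v; rewrite v0 /= => ->.
  by have := noi u; rewrite u0 /= => ->.
move=> /andP[i0 /eqP fi]; right; exists (f ord0); apply/ffunP => j.
rewrite ffunE; apply/eqP/negPn/negP => fj.
have j0 : j != ord0 by apply: contraNneq fj => ->.
(* Since [f i = f ord0], the edge from [ord0] to [j] and the non-edge from [i] to [j] have the same
   image pair, which would be both adjacent and not adjacent. *)
have := edge ord0 j; have := edge i j.
by rewrite fi !starE eqxx (negPf i0) (negPf j0) eq_sym fj /= => <-.
Qed.

(** Once the centre moves to a leaf, every leaf is forced onto the centre. *)
Lemma End_star_eq f g :
  f \in End_star n.+1 -> g \in End_star n.+1 ->
  f ord0 = g ord0 -> f ord0 != ord0 -> f = g.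
Proof.
move=> /End_starP fE /End_starP gE fg f0; apply/ffunP => i.
have [->//|i0] := eqVneq i ord0.
have /eqP -> : f i == ord0 by rewrite fE.
by apply/esym/eqP; rewrite gE -?fg.
Qed.

(** Serves to write the constant map to [c] as [z0] followed by an endomorphism. *)
Lemma End_star_to (c : 'I_n.+1) :
  exists2 f, f \in End_star n.+1 & f ord0 = c.
Proof.
have [->|c0] := eqVneq c ord0.
  by exists 1; [exact: End_star_one | exact: transf_oneE].
exists [ffun i => if i == ord0 then c else ord0]; last by rewrite ffunE eqxx.
by apply/End_starP => i i0; rewrite !ffunE (negPf i0) !eqxx c0.
Qed.

Lemma z0E : z0 n.+1 = transf_const ord0.
Proof. by apply/ffunP => i; apply/val_inj; rewrite /= /z0 transf_of_natE ?ffunE. Qed.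

End Star.

(** * The generators of the endomorphism monoid and words fixing the centre *)

Definition fixing_letter (x : End_letter) : bool :=
  if x is Lz then false else true.

Section Words.
Variable n : nat.
Hypothesis n_gt2 : 2 < n.
Notation rep := (represents (End_gen n.+1)).

Lemma b0E (i : 'I_n.+1) :
  b0 n.+1 i = (if i == 0 :> nat then 0 else if i < n then i.+1 else 1%N) :> nat.
Proof. have i_lt := ltn_ord i; rewrite /b0 transf_of_natE; repeat case: ifP; lia. Qed.

Lemma e0E (i : 'I_n.+1) : e0 n.+1 i = (if i == 2 :> nat then 1%N else i) :> nat.
Proof. have i_lt := ltn_ord i; rewrite /e0 transf_of_natE; repeat case: ifP; lia. Qed.

Lemma zE (i : 'I_n.+1) : z n.+1 i = (if i == 0 :> nat then 1%N else 0) :> nat.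
Proof. rewrite /z transf_of_natE; repeat case: ifP; lia. Qed.

Lemma fixing_letterE x : fixing_letter x -> End_gen n.+1 x ord0 = ord0.
Proof.
case: x => // _; apply: val_inj; rewrite /= ?b0E ?e0E //.
by rewrite transf_of_natE.
Qed.

Lemma fixing_wordE w : all fixing_letter w -> rep w ord0 = ord0.
Proof.
elim: w => [|x w IHw] /=; first by rewrite represents_nil transf_oneE.
by case/andP=> xf /IHw wf; rewrite represents_cons transf_mulE fixing_letterE.
Qed.

Lemma b0_wordE k (i : 'I_n.+1) :
  0 < i -> i + k <= n -> rep (nseq k Lb0) i = i + k :> nat.
Proof.
elim: k i => [|k IHk] i i0 ik; first by rewrite represents_nil transf_oneE addn0.
rewrite represents_cons transf_mulE.
have bi : b0 n.+1 i = i.+1 :> nat by rewrite b0E; repeat case: ifP; lia.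
by rewrite IHk /= bi; lia.
Qed.

Definition b0e0_word k := flatten (nseq k [:: Lb0; Le0]).

(* b_0 e_0 fixes 1 and shifts 2, ..., n - 1 up by one, sending the last to 1. *)
Lemma b0e0_wordE k (i : 'I_n.+1) :
  0 < i ->
  rep (b0e0_word k) i = (if (i == 1%N :> nat) || (n < i + k) then 1%N else i + k)
    :> nat.
Proof.
elim: k i => [|k IHk] i i0.
  rewrite represents_nil transf_oneE; have := ltn_ord i.
  by case: ifP; lia.
rewrite !represents_cons !transf_mulE.
have gi : e0 n.+1 (b0 n.+1 i) =
    (if (i == 1%N :> nat) || (i == n :> nat) then 1%N else i.+1) :> nat.
  by have := ltn_ord i; rewrite e0E b0E; repeat case: ifP; lia.
by have := ltn_ord i; rewrite IHk /= gi; repeat case: ifP; lia.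
Qed.

Definition collapse_word (j : 'I_n.+1) := b0e0_word n ++ nseq j.-1 Lb0.

Lemma collapse_word_fixing j : all fixing_letter (collapse_word j).
Proof.
rewrite all_cat all_nseq orbT andbT /b0e0_word.
by elim: n => //= k ->.
Qed.

Lemma collapse_wordE (i j : 'I_n.+1) :
  i != ord0 -> j != ord0 -> rep (collapse_word j) i = j.
Proof.
rewrite -!val_eqE /= => i0 j0; have := ltn_ord j => jn.
rewrite represents_cat transf_mulE.
(* A leaf has [0 < i], hence [n < i + n]: after [n] rounds every leaf has reached 1. The remaining
   [j.-1] shifts carry 1 to [j] without wrapping around. *)
have w1 : rep (b0e0_word n) i = 1%N :> nat by rewrite b0e0_wordE; [case: ifP|]; lia.
by apply: val_inj; rewrite /= b0_wordE w1; lia.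
Qed.

End Words.

(** * Consequences of the relations for words *)

Section Congruence.
Variable Q : seq End_letter -> seq End_letter -> Prop.
Notation "u ~~~ v" := (congruence_gen (swEnd_rel Q) u v) (at level 70).

Lemma congruence_gen_Lold u v :
  congruence_gen Q u v -> map Lold u ~~~ map Lold v.
Proof.
elim=> {u v} [u v Quv|u|u v _|u v w _ uv _|u u' v v' _ uu' _ vv'].
- exact/cong_rel/rel_Q.
- exact: cong_refl.
- exact: cong_sym.
- exact: cong_trans.
- by rewrite !map_cat; exact: cong_cat.
Qed.

Lemma cong_letter_z0 x : [:: x; Lz0] ~~~ [:: Lz0].
Proof. by case: x => [[]|]; apply: cong_rel; constructor. Qed.

Lemma cong_z0_letter x : fixing_letter x -> [:: Lz0; Lold x] ~~~ [:: Lz0].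
Proof. by case: x => // _; apply: cong_rel; constructor. Qed.

Lemma cong_z0_fixing u :
  all fixing_letter u -> Lz0 :: map Lold u ~~~ [:: Lz0].
Proof.
elim: u => [|x u IHu] /=; first by move=> _; exact: cong_refl.
case/andP=> /cong_z0_letter xz /IHu; apply: cong_trans.
exact: (cong_cat xz (cong_refl _ (map Lold u))).
Qed.

(** The last [Lz0] of a word absorbs every letter before it; what follows it is a word over the old
    letters. *)
Lemma swEnd_word_normal w :
  (exists u, w = map Lold u) \/ (exists u, w ~~~ Lz0 :: map Lold u).
Proof.
elim: w => [|x w [[u ->]|[u wu]]]; first by left; exists [::].
  case: x => [x|]; first by left; exists (x :: u).
  by right; exists u; exact: cong_refl.
right; exists u; apply: cong_trans (cong_cat (cong_refl _ [:: x]) wu) _.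
exact: (cong_cat (cong_letter_z0 x) (cong_refl _ (map Lold u))).
Qed.

End Congruence.

(** * Soundness, completeness and generation for the extended presentation *)

Section Presentation.
Variables (n : nat) (Q : seq End_letter -> seq End_letter -> Prop).
Hypothesis n_gt2 : 2 < n.
Hypothesis presQ : is_presentation (End_star n.+1) (End_gen n.+1) Q.
Notation rep := (represents (End_gen n.+1)).
Notation swrep := (represents (swEnd_gen n.+1)).
Notation "u ~~~ v" := (congruence_gen (swEnd_rel Q) u v) (at level 70).

Lemma represents_End w : rep w \in End_star n.+1.
Proof.
case: presQ => _ genE _ _; elim: w => [|x w IHw].
  by rewrite represents_nil; exact: End_star_one.
by rewrite represents_cons; apply: End_star_mul; first exact: genE.
Qed.

Lemma swrep_Lold w : swrep (map Lold w) = rep w.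
Proof. exact: big_map. Qed.

Lemma swrep_z0 w : swrep (Lz0 :: map Lold w) = transf_const (rep w ord0).
Proof. by rewrite represents_cons swrep_Lold /= z0E transf_const_mul. Qed.

Lemma swEnd_rel_sound u v : swEnd_rel Q u v -> swrep u = swrep v.
Proof.
case: presQ => _ _ _ QP; case=> [{}u {}v Quv||||||||].
  by rewrite !swrep_Lold; apply/QP/cong_rel.
all: rewrite !represents_cons !represents_nil !mulg1 /= z0E.
(* This leaves only the relations with [Lz0] followed by an old letter, which hold because that
   letter fixes the centre. *)
all: rewrite ?transf_mul_const ?transf_const_mul //.
- by rewrite (fixing_letterE n_gt2 (x := La0)).
- by rewrite (fixing_letterE n_gt2 (x := Lb0)).
- by rewrite (fixing_letterE n_gt2 (x := Le0)).
Qed.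

Lemma cong_z0_absorb u :
  rep u ord0 = ord0 -> Lz0 :: map Lold u ~~~ [:: Lz0].
Proof.
case: presQ => _ _ _ QP.
elim: u => [|x u IHu] u0; first exact: cong_refl.
case: (boolP (fixing_letter x)) => [xf|].
  have /IHu : rep u ord0 = ord0.
    by move: u0; rewrite represents_cons transf_mulE fixing_letterE.
  apply: cong_trans.
  exact: (cong_cat (cong_z0_letter Q xf) (cong_refl _ (map Lold u))).
case: x u0 => // u0 _; set j := rep u ord0.
have z_ne0 : z n.+1 ord0 != ord0 by rewrite -val_eqE /= zE.
(* The word [u] sends the leaf [z n.+1 ord0] back to the centre, and an endomorphism sending a leaf
   to the centre moves the centre. *)
have j0 : j != ord0.
  have /End_starP/(_ _ z_ne0) := represents_End u.
  by move: u0; rewrite represents_cons transf_mulE /= => ->; rewrite eqxx => <-.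
(* Under [z] every leaf passes through the centre and so ends at [j]. Both words represent the same
   endomorphism, so [Q] identifies them, and the second one avoids [Lz]. *)
have zu : rep (Lz :: u) = rep (collapse_word j).
  apply/ffunP => i; have [->|i0] := eqVneq i ord0.
    by rewrite u0 fixing_wordE ?collapse_word_fixing.
  rewrite collapse_wordE // represents_cons transf_mulE; congr (rep u _).
  by apply: val_inj; rewrite /= zE //; move: i0; rewrite -val_eqE /= => /negPf->.
apply: cong_trans (cong_z0_fixing Q (collapse_word_fixing j)).
apply: (cong_cat (cong_refl _ [:: Lz0])).
exact/congruence_gen_Lold/QP.
Qed.

Lemma cong_z0_Lold u v :
  rep u ord0 = rep v ord0 -> Lz0 :: map Lold u ~~~ Lz0 :: map Lold v.
Proof.
case: presQ => _ _ _ QP uv; have [u0|u0] := eqVneq (rep u ord0) ord0.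
  apply: cong_trans (cong_z0_absorb u0) (cong_sym _).
  by apply: cong_z0_absorb; rewrite -uv.
apply: (cong_cat (cong_refl _ [:: Lz0])); apply/congruence_gen_Lold/QP.
exact: End_star_eq (represents_End u) (represents_End v) uv u0.
Qed.

Lemma swEnd_rel_complete w1 w2 : swrep w1 = swrep w2 -> w1 ~~~ w2.
Proof.
case: presQ => _ _ _ QP.
have sound := congruence_gen_sound swEnd_rel_sound.
(* Excludes the mixed cases, where one word represents an endomorphism and the other a constant
   map. *)
have End_neq_const u c : rep u <> transf_const c.
  move=> uc; have := represents_End u.
  by rewrite uc; apply/negP/transf_const_notin_End; lia.
have [[u1 ->]|[u1 eq1]] := swEnd_word_normal Q w1;
  have [[u2 ->]|[u2 eq2]] := swEnd_word_normal Q w2.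
- by rewrite !swrep_Lold => /QP /congruence_gen_Lold.
- by rewrite (sound _ _ eq2) swrep_z0 swrep_Lold => /End_neq_const.
- by rewrite (sound _ _ eq1) swrep_z0 swrep_Lold => /esym/End_neq_const.
rewrite (sound _ _ eq1) (sound _ _ eq2) !swrep_z0 => /ffunP/(_ ord0).
rewrite !ffunE => /cong_z0_Lold eq12.
exact: cong_trans eq1 (cong_trans eq12 (cong_sym eq2)).
Qed.

Lemma swEnd_presentation :
  is_presentation (swEnd_star n.+1) (swEnd_gen n.+1) (swEnd_rel Q).
Proof.
have sound := congruence_gen_sound swEnd_rel_sound.
case: presQ => gen_inj genE genP _.
(* Needed for injectivity on the enlarged alphabet: [z0] is constant and the old generators are
   not. *)
have gen_neq_z0 x : End_gen n.+1 x <> z0 n.+1.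
  rewrite z0E => xz; have := genE x.
  by rewrite xz; apply/negP/transf_const_notin_End; lia.
split.
- case=> [x|] [y|] //=; first by move/gen_inj->.
    by move/gen_neq_z0.
  by move/esym/gen_neq_z0.
- case=> [x|] /=; first exact/End_star_sub_swEnd/genE.
  by rewrite z0E; exact: transf_const_swEnd.
- move=> f /swEnd_star_cases[/genP[w <-]|[c ->]].
    by exists (map Lold w); exact: swrep_Lold.
  have [g /genP[w <-] <-] := End_star_to c.
  by exists (Lz0 :: map Lold w); exact: swrep_z0.
- by move=> w1 w2; split; [exact: sound | exact: swEnd_rel_complete].
Qed.

End Presentation.

Theorem theorem3p2 (n : nat) (Q : seq End_letter -> seq End_letter -> Prop) :
  4 <= n ->
  is_presentation (End_star n) (End_gen n) Q ->
  is_presentation (swEnd_star n) (swEnd_gen n) (swEnd_rel Q).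
Proof. by case: n => [//|n] n_gt2; exact: swEnd_presentation. Qed.
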